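(* There exists an absolute constant $C>0$ such that for every positive integer $t$ and every finite graph $G$ of cliquewidth at most $t$, the hypergraph of balls in $G$ has a proper sample compression scheme of size at most $C\,t\log(t+1)$ (i.e. of size $\mathcal{O}(t\log t)$).
   Context: A hypergraph $H$ is a pair $(V(H),E(H))$ with $V(H)$ finite and $E(H)$ a set of subsets of $V(H)$. A sample of $H$ is a pair $(X^+,X^-)$ of subsets of $V(H)$ such that some $e\in E(H)$ satisfies $X^+\subseteq e$, $X^-\cap e=\emptyset$; $\mathcal{S}(H)$ denotes the set of samples. $S\subseteq V(H)$ realizes $(X^+,X^-)$ if $X^+\subseteq S$ and $S\cap X^-=\emptyset$. A subsample of $(X^+,X^-)$ is a sample $(Y^+,Y^-)$ with $Y^\pm\subseteq X^\pm$; its size is $|Y^+\cup Y^-|$. A sample compression scheme is a pair $(\kappa,\rho)$, $\kappa:\mathcal{S}(H)\to\mathcal{S}(H)\times\{0,1\}^*$, $\rho:\mathcal{S}(H)\times\{0,1\}^*\to 2^{V(H)}$, such that for every sample, the first component of $\kappa(X^+,X^-)$ is a subsample of $(X^+,X^-)$ and $\rho(\kappa(X^+,X^-))$ realizes $(X^+,X^-)$. Its size is $k_1+k_2$ where $k_1$ is the maximum size of the subsample and $k_2$ the maximum length of the bitstring output by $\kappa$. It is proper if all values of $\rho$ are hyperedges. For a graph $G$, $B_G(c,r)=\{v:\mathrm{dist}_G(c,v)\le r\}$ (shortest-path distance); the hypergraph of balls in $G$ has vertex set $V(G)$ and hyperedges all $B_G(c,r)$, $c\in V(G)$, $r$ an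 integer. The cliquewidth of $G$ is the minimum $k$ such that $G$ can be built using labels in $[k]$ by the operations: create a single vertex with a label; disjoint union; for labels $i\neq j$, add all edges between vertices labeled $i$ and vertices labeled $j$; relabel all vertices with label $i$ to label $j$. *)

(* Defs.v *)
From Stdlib Require Import Reals.
From mathcomp Require Import all_boot all_algebra.

Set Implicit Arguments.
Unset Strict Implicit.
Unset Printing Implicit Defensive.

(* A hypergraph on the finite vertex type V is given by its set of hyperedges,
   described as a predicate E on subsets of V. *)

Definition is_sample (V : finType) (E : {set V} -> Prop) (X : {set V} * {set V}) : Prop :=
  exists S : {set V}, E S /\ X.1 \subset S /\ X.2 :&: S = set0.

Definition realizes (V : finType) (S : {set V}) (X : {set V} * {set V}) : Prop :=
  X.1 \subset S /\ S :&: X.2 = set0.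

Definition is_subsample (V : finType) (E : {set V} -> Prop) (Y X : {set V} * {set V}) : Prop :=
  is_sample E Y /\ Y.1 \subset X.1 /\ Y.2 \subset X.2.

(* (kappa, rho) is a proper sample compression scheme for E whose subsamples
   have size at most k1 and whose bitstrings have length at most k2
   (so its size is at most k1 + k2). Bitstrings are seq bool. *)
Definition proper_compression_scheme (V : finType) (E : {set V} -> Prop)
  (kappa : {set V} * {set V} -> ({set V} * {set V}) * seq bool)
  (rho : ({set V} * {set V}) * seq bool -> {set V}) (k1 k2 : nat) : Prop :=
  (forall X, is_sample E X ->
     [/\ is_subsample E (kappa X).1 X,
         realizes (rho (kappa X)) X,
         #|(kappa X).1.1 :|: (kappa X).1.2| <= k1
       & size (kappa X).2 <= k2]) /\
  (forall Y (b : seq bool), is_sample E Y -> E (rho (Y, b))).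

Fixpoint reach (T : finType) (g : rel T) (n : nat) (c v : T) : bool :=
  match n with
  | 0 => c == v
  | n'.+1 => reach g n' c v || [exists w, reach g n' c w && g w v]
  end.

Definition ball (T : finType) (g : rel T) (c : T) (r : int) : {set T} :=
  match r with
  | Posz n => [set v | reach g n c v]
  | Negz _ => set0
  end.

Definition ball_hyperedge (T : finType) (g : rel T) (S : {set T}) : Prop :=
  exists (c : T) (r : int), S = ball g c r.

Inductive cw_expr : Type :=
  | CVtx of nat
  | CUnion of cw_expr & cw_expr
  | CJoin of nat & nat & cw_expr
  | CRelab of nat & nat & cw_expr.

Fixpoint cw_valid (k : nat) (x : cw_expr) : bool :=
  match x with
  | CVtx l => l < k
  | CUnion a b => cw_valid k a && cw_valid k b
  | CJoin i j a => [&& i < k, j < k, i != j & cw_valid k a]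
  | CRelab i j a => [&& i < k, j < k & cw_valid k a]
  end.

(* The vertices of the built graph are 0, ..., cw_size x - 1
   (the vertices of the left operand of a union come first). *)
Fixpoint cw_size (x : cw_expr) : nat :=
  match x with
  | CVtx _ => 1
  | CUnion a b => cw_size a + cw_size b
  | CJoin _ _ a => cw_size a
  | CRelab _ _ a => cw_size a
  end.

Fixpoint cw_label (x : cw_expr) (u : nat) : nat :=
  match x with
  | CVtx l => l
  | CUnion a b => if u < cw_size a then cw_label a u else cw_label b (u - cw_size a)
  | CJoin _ _ a => cw_label a u
  | CRelab i j a => if cw_label a u == i then j else cw_label a u
  end.

Fixpoint cw_adj (x : cw_expr) (u v : nat) : bool :=
  match x with
  | CVtx _ => false
  | CUnion a b =>
      if (u < cw_size a) && (v < cw_size a) then cw_adj a u v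
      else if (cw_size a <= u) && (cw_size a <= v)
           then cw_adj b (u - cw_size a) (v - cw_size a)
           else false
  | CJoin i j a =>
      [|| cw_adj a u v,
          (cw_label a u == i) && (cw_label a v == j)
        | (cw_label a u == j) && (cw_label a v == i)]
  | CRelab _ _ a => cw_adj a u v
  end.

(* G (on vertex type T with adjacency g) has cliquewidth at most k:
   G is isomorphic to the graph built by some expression using labels in [k].
   (The empty graph is conventionally of cliquewidth 0.) *)
Definition cliquewidth_le (T : finType) (g : rel T) (k : nat) : Prop :=
  #|T| = 0 \/
  exists (x : cw_expr) (f : T -> nat),
    [/\ cw_valid k x, injective f, (forall u, f u < cw_size x),
        #|T| = cw_size x
      & forall u v, g u v = cw_adj x (f u) (f v)].

(* Main.v *)
(** Let [F] be the laminar family of the vertex sets of the subexpressions of a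
    cliquewidth expression. Given a sample with realizing ball [B(c,r)], [c] not
    a sample point, there are [Q] and [P] in [F] such that [c] lies in [P \ Q]
    and every sample point lies in [Q] or outside [P]; moreover [Q] is the
    smallest member of [F] containing two suitable sample points [x], [y], and
    [P] is the largest member containing [x] and avoiding a third one, [z].
    Both cuts have at most [t] neighbourhood classes, and a path leaving through
    class [i] splits at the cut, so the trace of [B(c,r)] on either side is a
    union of [t] sets, the [i]-th of which ranges over a chain as the centre
    ranges over [P \ Q] and the radius varies. Keeping, for each chain, the last
    positive point covered and the first negative point excluded forces every
    ball centred in [P \ Q] that agrees on these points to realize the sample.
    The bits say which of the O(t) kept points plays which role. *)
Require Import Defs.
From Stdlib Require Import Reals Classical Lra.
From mathcomp Require Import all_boot all_algebra zify.

Set Implicit Arguments.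
Unset Strict Implicit.
Unset Printing Implicit Defensive.

(** * Chains of sets and their certificates *)

Lemma total_preorder_max (V : finType) (R : V -> V -> Prop) (A : {set V}) :
  (forall x y, R x y \/ R y x) -> (forall x y z, R x y -> R y z -> R x z) ->
  A != set0 -> exists2 x, x \in A & forall y, y \in A -> R y x.
Proof.
move=> Rtot Rtr; have Rxx x : R x x by case: (Rtot x x).
have [n] := ubnP #|A|; elim: n A => // n IHn A leAn /set0Pn[x xA].
have [A0|A'n0] := eqVneq (A :\ x) set0.
  exists x => // y yA; suff -> : y = x by [].
  by apply/eqP/negP => /negP yx; have := in_set0 y; rewrite -A0 !inE yx yA.
have [|z] := IHn (A :\ x) _ A'n0; first by rewrite (cardsD1 x) xA in leAn.
rewrite !inE => /andP[_ zA] zmax.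
have [Rxz|Rzx] := Rtot x z.
  by exists z => // y yA; have [-> //|yx] := eqVneq y x; apply: zmax; rewrite !inE yx.
exists x => // y yA; have [-> //|yx] := eqVneq y x.
by apply: Rtr Rzx; apply: zmax; rewrite !inE yx.
Qed.

Lemma exists_injection (A B : finType) :
  #|A| <= #|B| -> exists f : A -> B, injective f.
Proof.
move=> leAB; exists (fun a => enum_val (widen_ord leAB (enum_rank a))) => a a'.
by move/enum_val_inj/(congr1 val) => /= /ord_inj; apply: enum_rank_inj.
Qed.

(* The first clause says that, for fixed [i], the sets [U i S] form a chain. *)
Definition chain_union (I V : finType) (D : {set V} -> Prop) (W : {set V})
    (U : I -> {set V} -> V -> Prop) : Prop :=
  (forall i v w, (forall S, U i S v -> U i S w) \/ (forall S, U i S w -> U i S v)) /\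
  (forall S, D S -> forall v, v \in W -> (v \in S <-> exists i, U i S v)).

(** [f i true] is the positive point kept for chain [i] and [f i false] the negative one; [None]
    imposes no condition. *)
Definition agrees (I V : finType) (U : I -> {set V} -> V -> Prop)
    (f : I -> bool -> option V) (S : {set V}) : Prop :=
  forall i v, (f i true = Some v -> U i S v) /\ (f i false = Some v -> ~ U i S v).

(** Each positive point is charged to a chain through which [S0] covers it, whereas a negative point
    has to stay out of every chain. *)
Lemma chain_certificate (I V : finType) (D : {set V} -> Prop) (W : {set V})
    (U : I -> {set V} -> V -> Prop) (X : {set V} * {set V}) (S0 : {set V}) :
  chain_union D W U -> D S0 -> realizes S0 X -> X.1 :|: X.2 \subset W ->
  exists f : I -> bool -> option V,
    [/\ forall i b v, f i b = Some v -> v \in X.1 :|: X.2,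
        agrees U f S0
      & forall S, D S -> agrees U f S -> realizes S X].
Proof.
move=> [Utot UD] DS0 [X1S0 X2S0] XW.
have X2S0' v : v \in X.2 -> v \notin S0.
  by move=> vX; apply/negP => vS; have := in_set0 v; rewrite -X2S0 inE vS vX.
(* In chain [i], [v] enters no later than [w]. *)
pose le i v w := forall S, U i S w -> U i S v.
have le_trans i : forall u v w, le i u v -> le i v w -> le i u w.
  by move=> u v w luv lvw S /lvw /luv.
have pos i : exists o : option V,
    (forall v, o = Some v -> v \in X.1 /\ U i S0 v) /\
    (forall S, (forall v, o = Some v -> U i S v) ->
       forall v, v \in X.1 -> U i S0 v -> U i S v).
  have [A Adef] : exists A : {set V}, forall v, v \in A <-> v \in X.1 /\ U i S0 v.
    have /fin_all_exists[f fP] v : exists b : bool, b <-> v \in X.1 /\ U i S0 v.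
      by case: (classic (v \in X.1 /\ U i S0 v)) => H; [exists true|exists false].
    by exists [set v | f v] => v; rewrite inE.
  have [A0|An0] := eqVneq A set0.
    exists None; split=> // S _ v vX Uv.
    by have := in_set0 v; rewrite -A0 (introT idP ((Adef v).2 (conj vX Uv))).
  have [|x xA xmax] := @total_preorder_max _ (le i) A _ (le_trans i) An0.
    by move=> v w; case: (Utot i v w); [right|left].
  exists (Some x); split=> [v [<-]|S US v vX Uv]; first exact/Adef.
  by apply: (xmax v) (US x erefl); apply/Adef.
(* The point kept is the first of [X.2] to enter the chain: excluding it excludes the others. *)
have neg i : exists o : option V,
    (forall v, o = Some v -> v \in X.2) /\
    (forall S, (forall v, o = Some v -> ~ U i S v) ->
       forall v, v \in X.2 -> ~ U i S v).
  have [A0|An0] := eqVneq X.2 set0.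
    by exists None; split=> // S _ v; rewrite A0 inE.
  have [||x xA xmax] := @total_preorder_max _ (fun v w => le i w v) X.2 _ _ An0.
  - by move=> v w; case: (Utot i v w); [left|right].
  - by move=> u v w luv lvw; apply: le_trans lvw luv.
  exists (Some x); split=> [v [<-] //|S US v vX Uv].
  by apply: (US x erefl); apply: (xmax v vX).
have [p pP] := fin_all_exists pos; have [m mP] := fin_all_exists neg.
exists (fun i b => if b then p i else m i); split=> [i [] v Ev|i v|S DS ag].
- by rewrite inE ((pP i).1 v Ev).1.
- by rewrite inE ((mP i).1 v Ev) orbT.
- split=> Ev; first exact: ((pP i).1 v Ev).2.
  have vX := (mP i).1 v Ev => Uv.
  have vW : v \in W by rewrite (subsetP XW) // inE vX orbT.
  by move: (X2S0' _ vX); rewrite ((UD S0 DS0 v vW).2 _) //; exists i.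
split.
  apply/subsetP => v vX; have vW : v \in W by rewrite (subsetP XW) // inE vX.
  have [i Ui] := (UD S0 DS0 v vW).1 (subsetP X1S0 v vX).
  apply/(UD S DS v vW); exists i.
  by apply: (pP i).2 => // w; case: (ag i w).
apply/setP => v; rewrite !inE; apply/negP => /andP[vS vX].
have vW : v \in W by rewrite (subsetP XW) // inE vX orbT.
have [i] := (UD S DS v vW).1 vS.
by apply: (mP i).2 => // w; case: (ag i w).
Qed.

(** * From scenes to compression schemes *)

(** A scene [s] is a partial map from [B] to vertices; the message is the scene
    together with a chain certificate, and the bits give, for each of its
    entries, its rank in the enumeration of the subsample. *)
Lemma scheme_of_scenes (V B I : finType) (E : {set V} -> Prop)
    (D : {ffun B -> option V} -> {set V} -> Prop)
    (W : {ffun B -> option V} -> {set V}) (l : nat) :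
  let K := #|B| + #|I| * 2 in
  K < 2 ^ l ->
  (forall s S, D s S -> E S) ->
  (forall s, exists U : I -> {set V} -> V -> Prop, chain_union (D s) (W s) U) ->
  (forall X, is_sample E X -> exists s S,
     [/\ D s S, realizes S X, X.1 :|: X.2 \subset W s
       & forall b v, s b = Some v -> v \in X.1 :|: X.2]) ->
  exists kappa rho, proper_compression_scheme E kappa rho K (l * K).
Proof.
move=> K Kl DE /fin_all_exists[U UP] sceneP.
pose J : finType := (B + I * bool)%type.
have cardJ : #|J| = K by rewrite card_sum card_prod card_bool.
(* The subsample has at most [K] points, so [K.+1] values leave room for a rank past the end of its
   enumeration, which decodes to [None]. *)
pose A : finType := {ffun J -> 'I_K.+1}.
pose dec (Y : {set V} * {set V}) (a : A) (j : J) : option V :=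
  nth None [seq Some v | v <- enum (Y.1 :|: Y.2)] (a j).
pose scene Y a : {ffun B -> option V} := [ffun b => dec Y a (inl b)].
pose cons Y a S := D (scene Y a) S /\
  agrees (U (scene Y a)) (fun i b => dec Y a (inr (i, b))) S.
(* Since [K.+1 <= 2 ^ l], the [K.+1 ^ K] messages fit into [l * K] bits. *)
have leA : #|A| <= #|{: (l * K).-tuple bool}|.
  rewrite card_ffun card_ord cardJ card_tuple card_bool expnM.
  by have [->|K0] := posnP K; rewrite ?expn0 // leq_exp2r.
have [enc enc_inj] := exists_injection leA.
(* Any set consistent with the message will do. When there is none, a sample is sent to an arbitrary
   hyperedge, which keeps the scheme proper on bitstrings never sent. *)
have decodeP (Ya : ({set V} * {set V}) * option A) : exists S,
    (is_sample E Ya.1 -> E S) /\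
    (forall a, Ya.2 = Some a -> (exists S', cons Ya.1 a S') -> cons Ya.1 a S).
  case: Ya => Y oa.
  case: (classic (exists S, exists2 a, oa = Some a & cons Y a S)).
    move=> [S [a /= -> cS]]; exists S; split=> [_|_ [<-] //].
    exact: DE cS.1.
  move=> nex; case: (classic (is_sample E Y)) => [[S [ES _]]|nS].
    by exists S; split=> // a Ea [S' cS']; case: nex; exists S', a.
  by exists set0; split=> // a Ea [S' cS']; case: nex; exists S', a.
have [rho' rhoP] := fin_all_exists decodeP.
pose rho (Yb : ({set V} * {set V}) * seq bool) :=
  rho' (Yb.1, [pick a | val (enc a) == Yb.2]).
have kappaP X : exists Ya : ({set V} * {set V}) * A, is_sample E X ->
    [/\ is_subsample E Ya.1 X, #|Ya.1.1 :|: Ya.1.2| <= K,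
        exists S, cons Ya.1 Ya.2 S
      & forall S, cons Ya.1 Ya.2 S -> realizes S X].
  case: (classic (is_sample E X)) => [sX|nX]; last first.
    by exists ((set0, set0), [ffun=> ord0]).
  have [s [S0 [DS0 rS0 XW sX']]] := sceneP X sX.
  have [f [fX agS0 fP]] := chain_certificate (UP s) DS0 rS0 XW.
  pose msg (j : J) := match j with inl b => s b | inr (i, b) => f i b end.
  have msgX j v : msg j = Some v -> v \in X.1 :|: X.2.
    by case: j => [b|[i b]] /=; [apply: sX'|apply: fX].
  pose M := [set v | [exists j, msg j == Some v]].
  (* Signs are inherited from [X]; the decoder reads only the union and the ranks. *)
  pose Y := (X.1 :&: M, X.2 :&: M).
  have YM : Y.1 :|: Y.2 = M.
    apply/setP => v; rewrite !inE -andb_orl; apply: andb_idl => /existsP[j /eqP].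
    by move/msgX; rewrite inE.
  have cardM : #|M| <= K.
    rewrite -cardJ; apply: leq_trans (leq_imset_card msg predT).
    rewrite -(card_imset (mem M) Some_inj); apply/subset_leq_card/subsetP => o.
    case/imsetP => v; rewrite inE => /existsP[j /eqP Ej] ->.
    by apply/imsetP; exists j.
  have rank_bound j : index (msg j) [seq Some v | v <- enum (Y.1 :|: Y.2)] < K.+1.
    by rewrite ltnS; apply: leq_trans (index_size _ _) _; rewrite size_map -cardE YM.
  pose a : A := [ffun j => Ordinal (rank_bound j)].
  have decE j : dec Y a j = msg j.
    rewrite /dec ffunE /=; case Ej: (msg j) => [v|].
      apply: nth_index; apply: map_f; rewrite mem_enum YM inE.
      by apply/existsP; exists j; apply/eqP.
    set sq := map _ _; have [lt|] := ltnP (index None sq) (size sq); last exact: nth_default.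
    by rewrite nth_index // -index_mem.
  have sceneE : scene Y a = s by apply/ffunP => b; rewrite ffunE decE.
  exists (Y, a) => _; rewrite /cons /= sceneE.
  have agE S : agrees (U s) (fun i b => dec Y a (inr (i, b))) S <-> agrees (U s) f S.
    by split=> ag i v; have := ag i v; rewrite !decE.
  split.
  - split; last by rewrite /= !subsetIl.
    case: sX => S [ES [X1S X2S]]; exists S; split=> //; split.
      exact: subset_trans (subsetIl _ _) X1S.
    apply/eqP; rewrite -subset0 -X2S; apply: setSI; exact: subsetIl.
  - by rewrite YM.
  - by exists S0; split; last exact/agE.
  - by move=> S [DS /agE]; apply: fP.
have [kap kapP] := fin_all_exists kappaP.
exists (fun X => ((kap X).1, val (enc (kap X).2))), rho; split=> [X /kapP|Y b sY].
  move=> [sub card_le exS allS].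
  split=> //=; last by rewrite size_tuple.
  apply: allS; rewrite /rho /=.
  case: pickP => [a /eqP/val_inj/enc_inj ->|/(_ (kap X).2)]; last by rewrite eqxx.
  exact: (rhoP ((kap X).1, Some (kap X).2)).2.
exact: (rhoP (Y, _)).1.
Qed.

(** * The laminar family of subexpressions *)

Definition shift (d : nat) (I : nat * nat) := (d + I.1, d + I.2).

(** As the left operand of a union is numbered first, every subexpression occupies a half-open
    interval of vertex numbers. Joins and relabellings keep the vertex set and add no interval. *)
Fixpoint subintervals (x : cw_expr) : seq (nat * nat) :=
  match x with
  | CVtx _ => [:: (0, 1)]
  | CUnion a b => (0, cw_size a + cw_size b) ::
      subintervals a ++ map (shift (cw_size a)) (subintervals b)
  | CJoin _ _ a => subintervals a
  | CRelab _ _ a => subintervals a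
  end.

Definition in_interval (I : nat * nat) (u : nat) := (I.1 <= u) && (u < I.2).

Lemma subinterval_bounds (x : cw_expr) (I : nat * nat) :
  I \in subintervals x -> I.1 < I.2 <= cw_size x.
Proof.
elim: x I => [l|a IHa b IHb|i j a IHa|i j a IHa] I /=; last 2 first.
- exact: IHa.
- exact: IHa.
- by rewrite inE => /eqP ->.
have full y : 0 < cw_size y by elim: y => //= y y0 z _; rewrite ltn_addr.
rewrite inE mem_cat => /or3P[/eqP -> /=|/IHa|/mapP[J /IHb bJ ->] /=].
- by rewrite leqnn andbT ltn_addr.
- lia.
- lia.
Qed.

Lemma subinterval_full (x : cw_expr) : (0, cw_size x) \in subintervals x.
Proof. by elim: x => //= a _ b _; rewrite inE eqxx. Qed.

Lemma subintervals_laminar (x : cw_expr) (I J : nat * nat) :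
  I \in subintervals x -> J \in subintervals x ->
  [\/ I.2 <= J.1, J.2 <= I.1, (J.1 <= I.1) && (I.2 <= J.2)
    | (I.1 <= J.1) && (J.2 <= I.2)].
Proof.
elim: x I J => [l|a IHa b IHb|i j a IHa|i j a IHa] I J /=; last 2 first.
- exact: IHa.
- exact: IHa.
- by rewrite !inE => /eqP -> /eqP ->; constructor 3.
move=> sI sJ; have bI := @subinterval_bounds (CUnion a b) I sI.
have bJ := @subinterval_bounds (CUnion a b) J sJ.
move: bI bJ sI sJ; rewrite !inE !mem_cat /= => bI bJ.
move=> /or3P[/eqP EI|aI|/mapP[I' bI' EI]].
- by move=> _; constructor 4; rewrite EI /=; lia.
- move=> /or3P[/eqP EJ|aJ|/mapP[J' bJ' EJ]].
  + by constructor 3; rewrite EJ /=; lia.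
  + exact: IHa.
  + have := subinterval_bounds aI; rewrite EJ /= => ?; constructor 1; lia.
- move=> /or3P[/eqP EJ|aJ|/mapP[J' bJ' EJ]].
  + by constructor 3; rewrite EJ /=; lia.
  + have := subinterval_bounds aJ; rewrite EI /= => ?; constructor 2; lia.
  + by case: (IHb _ _ bI' bJ') => H; rewrite EI EJ /=;
      [constructor 1|constructor 2|constructor 3|constructor 4]; lia.
Qed.

Lemma subinterval_split (x : cw_expr) (I : nat * nat) :
  I \in subintervals x -> I.2 = I.1.+1 \/
  exists m, [/\ I.1 < m < I.2, (I.1, m) \in subintervals x & (m, I.2) \in subintervals x].
Proof.
elim: x I => [l|a IHa b IHb|i j a IHa|i j a IHa] I /=; last 2 first.
- exact: IHa.
- exact: IHa.
- by rewrite inE => /eqP ->; left.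
rewrite inE mem_cat => /or3P[/eqP -> /=|aI|/mapP[J bJ ->] /=].
- right; exists (cw_size a).
  have := subinterval_bounds (subinterval_full a).
  have := subinterval_bounds (subinterval_full b) => /= b0 a0.
  rewrite !inE !mem_cat subinterval_full orbT; split=> //; first by lia.
  apply/or3P; constructor 3; apply/mapP; exists (0, cw_size b).
    exact: subinterval_full.
  by rewrite /shift addn0.
- have [E|[m [lt s1 s2]]] := IHa I aI; [by left|right; exists m].
  by rewrite !inE !mem_cat s1 s2 !orbT.
- have [E|[m [lt s1 s2]]] := IHb J bJ; [by left; lia|right; exists (cw_size a + m)].
  rewrite !inE !mem_cat; split; first by lia.
    by apply/or3P; constructor 3; apply/mapP; exists (J.1, m).
  by apply/or3P; constructor 3; apply/mapP; exists (m, J.2).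
Qed.

Lemma cw_label_lt (k : nat) (x : cw_expr) (u : nat) :
  cw_valid k x -> u < cw_size x -> cw_label x u < k.
Proof.
elim: x u => [l|a IHa b IHb|i j a IHa|i j a IHa] u //=.
- move=> /andP[va vb] ult; case: (ltnP u (cw_size a)) => [|ge]; first exact: IHa.
  by apply: IHb => //; lia.
- by move=> /and4P[_ _ _ va]; apply: IHa.
- by move=> /and3P[_ jk va] us; case: ifP => // _; apply: IHa.
Qed.

(* The clause on [cw_label] makes the induction go through [CJoin]. *)
Lemma subinterval_classes (k : nat) (x : cw_expr) (I : nat * nat) :
  cw_valid k x -> I \in subintervals x ->
  exists lab : nat -> nat, (forall u, in_interval I u -> lab u < k) /\
    forall u v, in_interval I u -> in_interval I v -> lab u = lab v ->
      cw_label x u = cw_label x v /\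
      forall w, w < cw_size x -> ~~ in_interval I w -> cw_adj x u w = cw_adj x v w.
Proof.
rewrite /in_interval.
elim: x I => [l|a IHa b IHb|i j a IHa|i j a IHa] I /=.
- move=> lk; rewrite inE => /eqP ->; exists (fun=> l); split=> // u v _ _ _; split.
- move=> /andP[va vb]; rewrite inE mem_cat => /or3P[/eqP -> /=|aI|/mapP[J bJ ->] /=].
  (* Nothing lies outside the full interval, so only the label clause matters. *)
  + exists (cw_label (CUnion a b)); split=> [u us|u v _ _ E].
      by apply: cw_label_lt => //=; rewrite va vb.
    by split=> // w; lia.
  + have [lab [labk labP]] := IHa I va aI; have := subinterval_bounds aI => bI.
    exists lab; split=> // u v uI vI E; have [El Ea] := labP u v uI vI E.
    have [-> ->] : u < cw_size a /\ v < cw_size a by lia.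
    split=> // w ws nw; case: (ltnP w (cw_size a)) => /= wa; first exact: Ea.
    have [-> ->] // : cw_size a <= u = false /\ cw_size a <= v = false by lia.
  + have [lab [labk labP]] := IHb J vb bJ; have := subinterval_bounds bJ => bJ'.
    exists (fun u => lab (u - cw_size a)); split=> [u uI|u v uI vI E].
      by apply: labk; lia.
    have [||//|El Ea] := labP (u - cw_size a) (v - cw_size a); [lia|lia|].
    have [-> ->] : u < cw_size a = false /\ v < cw_size a = false by lia.
    have [-> ->] : cw_size a <= u /\ cw_size a <= v by lia.
    split=> //= w ws nw; case: ifP => // wa; apply: Ea; lia.
- move=> /and4P[_ _ _ va] aI; have [lab [labk labP]] := IHa I va aI.
  exists lab; split=> // u v uI vI E; have [El Ea] := labP u v uI vI E.
  by split=> // w ws nw; rewrite El Ea.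
- move=> /and3P[_ _ va] aI; have [lab [labk labP]] := IHa I va aI.
  exists lab; split=> // u v uI vI E; have [El Ea] := labP u v uI vI E.
  by split=> [|w ws nw]; rewrite ?El ?Ea.
Qed.

(** * Cut families of a graph *)

(** From here on a cliquewidth expression is seen only through these properties. The splitting
    clause is stated from the side of a vertex [c]: one child contains it, the other avoids it. *)
Record cut_family (t : nat) (T : finType) (g : rel T) (F : {set {set T}}) : Prop := {
    cut_full : setT \in F;
    cut_laminar : forall A B, A \in F -> B \in F ->
      [\/ A \subset B, B \subset A | [disjoint A & B]];
    cut_split : forall A c, A \in F -> c \in A -> A = [set c] \/
      exists A1 A2, [/\ A1 \in F, A2 \in F, c \in A1, A1 \proper A & c \notin A2 /\ A1 :|: A2 = A];
    cut_classes : forall A, A \in F -> exists lab : T -> 'I_t,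
      forall u v w, u \in A -> v \in A -> lab u = lab v -> w \notin A -> g u w = g v w
  }.

Lemma cliquewidth_cut_family (t : nat) (T : finType) (g : rel T) :
  0 < #|T| -> 0 < t -> cliquewidth_le g t -> exists F, cut_family t g F.
Proof.
move=> T0 t0 [T0'|[x [f [vx f_inj f_lt cT gE]]]]; first by rewrite T0' in T0.
pose iset I := [set u | in_interval I (f u)].
pose F := [set A | A \in map iset (subintervals x)].
have FP A : reflect (exists2 I, I \in subintervals x & A = iset I) (A \in F).
  by rewrite inE; apply: mapP.
(* Surjectivity provides the vertex of the sibling that makes a child a proper subset. *)
have f_surj v : v < cw_size x -> exists u, f u = v.
  move=> vs; pose f' u : 'I_(cw_size x) := Ordinal (f_lt u).
  have f'_inj : injective f' by move=> u w /(congr1 val) /f_inj.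
  have [//|g' _ g'K] := inj_card_bij f'_inj; first by rewrite card_ord cT.
  by exists (g' (Ordinal vs)); have /(congr1 val) := g'K (Ordinal vs).
exists F; split.
- apply/FP; exists (0, cw_size x); first exact: subinterval_full.
  by apply/setP => u; rewrite !inE /in_interval /= f_lt.
- move=> _ _ /FP[I sI ->] /FP[J sJ ->].
  have [H|H|H|H] := subintervals_laminar sI sJ.
  + by constructor 3; rewrite -setI_eq0; apply/eqP/setP => u; rewrite !inE /in_interval; lia.
  + by constructor 3; rewrite -setI_eq0; apply/eqP/setP => u; rewrite !inE /in_interval; lia.
  + by constructor 1; apply/subsetP => u; rewrite !inE /in_interval; lia.
  + by constructor 2; apply/subsetP => u; rewrite !inE /in_interval; lia.
- move=> _ c /FP[[lo hi] sI ->]; rewrite inE => cI.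
  have [/= EI|[m [/= Im s1 s2]]] := subinterval_split sI.
    left; apply/setP => u; rewrite !inE; move: cI; rewrite /in_interval EI /= => cI.
    by rewrite -(inj_eq f_inj); lia.
  have /= bI := subinterval_bounds sI.
  right; have [cm|cm] := ltnP (f c) m.
    exists (iset (lo, m)), (iset (m, hi)); split.
    + by apply/FP; exists (lo, m).
    + by apply/FP; exists (m, hi).
    + by rewrite inE /in_interval /= in cI *; lia.
    + apply/properP; split; first by apply/subsetP => u; rewrite !inE /in_interval /=; lia.
      have [|u Eu] := f_surj m; first by lia.
      by exists u; rewrite inE /in_interval /= Eu; lia.
    + split; first by rewrite inE /in_interval /=; lia.
      by apply/setP => u; rewrite !inE /in_interval /=; lia.
  exists (iset (m, hi)), (iset (lo, m)); split.
  + by apply/FP; exists (m, hi).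
  + by apply/FP; exists (lo, m).
  + by rewrite inE /in_interval /= in cI *; lia.
  + apply/properP; split; first by apply/subsetP => u; rewrite !inE /in_interval /=; lia.
    have [|u Eu] := f_surj lo; first by lia.
    by exists u; rewrite inE /in_interval /= Eu; lia.
  + split; first by rewrite inE /in_interval /=; lia.
    by apply/setP => u; rewrite !inE /in_interval /=; lia.
- move=> _ /FP[I sI ->]; have [lab [labt labP]] := subinterval_classes vx sI.
  (* The default [Ordinal t0] can occur only outside the interval, where [lab] is not bounded. *)
  exists (fun u => insubd (Ordinal t0) (lab (f u))) => u v w.
  rewrite !inE => uI vI E wI; rewrite !gE.
  apply: (labP _ _ uI vI _).2 => //.
  by move/(congr1 val): E; rewrite !val_insubd !labt.
Qed.

(** * Walks through cuts and gates *)

Lemma reach_mono (T : finType) (g : rel T) (m n : nat) (c v : T) :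
  m <= n -> reach g m c v -> reach g n c v.
Proof.
by move=> /subnKC <-; elim: (n - m) => [|k IHk]; rewrite ?addn0 // addnS /= => /IHk ->.
Qed.

Lemma reach_trans (T : finType) (g : rel T) (m n : nat) (c u v : T) :
  reach g m c u -> reach g n u v -> reach g (m + n) c v.
Proof.
move=> cu; elim: n v => [|n IHn] v; first by rewrite addn0 /= => /eqP <-.
rewrite addnS /= => /orP[/IHn -> //|/existsP[w /andP[/IHn cw wv]]].
by apply/orP; right; apply/existsP; exists w; rewrite cw.
Qed.

Lemma reach_edge (T : finType) (g : rel T) (u v : T) : g u v -> reach g 1 u v.
Proof. by move=> uv /=; apply/orP; right; apply/existsP; exists u; rewrite eqxx. Qed.

(** Reading the walk backwards finds the last edge leaving [A]; the successor in [n.+1] counts this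
    edge. *)
Lemma reach_cross (T : finType) (g : rel T) (A : {set T}) (r : nat) (c v : T) :
  c \in A -> v \notin A -> reach g r c v ->
  exists m n u w, [/\ m + n.+1 <= r, reach g m c u, u \in A /\ w \notin A,
                      g u w & reach g n w v].
Proof.
move=> cA; elim: r v => [|r IHr] v vA /=; first by move=> /eqP Ecv; rewrite -Ecv cA in vA.
move=> /orP[/(IHr v vA)[m [n [u [w [mn]]]]]|/existsP[w0 /andP[cw0 w0v]]].
  by exists m, n, u, w; split=> //; lia.
have [w0A|w0A] := boolP (w0 \in A).
  by exists r, 0, w0, v; split=> //=; rewrite addn1.
have [m [n [u [w [mn cu uw guw ww0]]]]] := IHr w0 w0A cw0.
exists m, n.+1, u, w; split=> //; first by lia.
by rewrite -addn1; apply: reach_trans ww0 (reach_edge w0v).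
Qed.

(** Paths from [Z] to [W] are forced through one of [t] gates: [alpha i c m] says
    that gate [i] is reached from [c] in [m] steps, [beta i v n] that [v] is
    reached from gate [i] in [n] steps. *)
Definition gates (t : nat) (T : finType) (g : rel T) (Z W : {set T}) : Prop :=
  exists alpha beta : 'I_t -> T -> nat -> Prop,
    (forall i v n n', n <= n' -> beta i v n -> beta i v n') /\
    forall c v r, c \in Z -> v \in W ->
      (reach g r c v <-> exists i m n, [/\ m + n <= r, alpha i c m & beta i v n]).

Lemma gates_sub (t : nat) (T : finType) (g : rel T) (Z Z' W : {set T}) :
  Z' \subset Z -> gates t g Z W -> gates t g Z' W.
Proof.
move=> sZ [al [be [mono gP]]]; exists al, be; split=> // c v r cZ.
by apply: gP; apply: (subsetP sZ).
Qed.

(** Balls with a fixed centre already form a chain, so all [t] gates can be copies of the centre. *)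
Lemma gates_point (t : nat) (T : finType) (g : rel T) (c : T) :
  0 < t -> gates t g [set c] setT.
Proof.
move=> t0; exists (fun _ _ _ => True), (fun _ v n => reach g n c v).
split=> [i v n n'|c' v r /set1P -> _]; first exact: reach_mono.
split=> [cv|[i [m [n [mn _]]]]]; last by apply: reach_mono; lia.
by exists (Ordinal t0), 0, r.
Qed.

(** Gate [i] is class [i] of [A]. The two halves of a walk may use different vertices [u] and [u']
    of the class, but these have the same neighbours outside [A], so the edge from [u'] to [w] can
    be traded for one from [u]. *)
Lemma gates_out (t : nat) (T : finType) (g : rel T) (F : {set {set T}}) (A : {set T}) :
  cut_family t g F -> A \in F -> gates t g A (~: A).
Proof.
move=> cF /(cut_classes cF)[lab labP].
exists (fun i c m => exists u, [/\ u \in A, lab u = i & reach g m c u]).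
(* The crossing edge is charged to the second half, and the inequality makes it monotone in [n]. *)
exists (fun i v n => exists n' u w,
  [/\ n'.+1 <= n, u \in A /\ lab u = i, w \notin A, g u w & reach g n' w v]).
split=> [i v n n' nn' [k [u [w [kn uA wA uw wv]]]]|c v r cA].
  by exists k, u, w; split=> //; apply: leq_trans nn'.
rewrite inE => vA; split=> [/(reach_cross cA vA)|].
  move=> [m [n [u [w [mn cu [uA wA] uw wv]]]]].
  by exists (lab u), m, n.+1; split=> //; [exists u|exists n, u, w].
move=> [i [m [n [mn [u [uA Eu cu]] [n' [u' [w [n'n [u'A Eu'] wA u'w wv]]]]]]]].
have uw : g u w by rewrite (labP u u' w) // Eu.
apply: reach_mono (reach_trans cu (reach_trans (reach_edge uw) wv)); lia.
Qed.

(** The same exchange for walks entering [A]; symmetry turns the crossing edge around, since classes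
    compare edges that leave [A]. *)
Lemma gates_in (t : nat) (T : finType) (g : rel T) (F : {set {set T}}) (A : {set T}) :
  symmetric g -> cut_family t g F -> A \in F -> gates t g (~: A) A.
Proof.
move=> gC cF /(cut_classes cF)[lab labP].
exists (fun i c m => exists u w,
  [/\ u \in A, lab u = i, w \notin A, g u w & reach g m c w]).
exists (fun i v n => exists n' u, [/\ n'.+1 <= n, u \in A, lab u = i & reach g n' u v]).
split=> [i v n n' nn' [k [u [kn uA Eu uv]]]|c v r].
  by exists k, u; split=> //; apply: leq_trans nn'.
rewrite inE => cA vA; split=> [cv|].
  have [|||m [n [w [u [mn cw []]]]]] := @reach_cross T g (~: A) r c v; rewrite ?inE ?negbK //.
  move=> wA uA wu uv; exists (lab u), m, n.+1; split=> //; last by exists n, u.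
  by exists u, w; split=> //; rewrite gC.
move=> [i [m [n [mn [u [w [uA Eu wA uw cw]]] [n' [u' [n'n u'A Eu' u'v]]]]]]].
have wu' : g w u' by rewrite gC (labP u' u w) // Eu'.
apply: reach_mono (reach_trans cw (reach_trans (reach_edge wu') u'v)); lia.
Qed.

Definition centred (T : finType) (g : rel T) (Z S : {set T}) : Prop :=
  exists c (r : nat), c \in Z /\ S = ball g c (Posz r).

(** Behind a fixed gate only the remaining budget [n] matters, and points enter in the order of the
    budget they need. The boolean tells the two sides apart. *)
Lemma gates_chain_union (t : nat) (T : finType) (g : rel T) (Z W1 W2 : {set T}) :
  gates t g Z W1 -> gates t g Z W2 ->
  exists U : bool * 'I_t -> {set T} -> T -> Prop, chain_union (centred g Z) (W1 :|: W2) U.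
Proof.
move=> G1 G2; pose W (b : bool) := if b then W1 else W2.
have /fin_all_exists[al] b : exists al, exists be : 'I_t -> T -> nat -> Prop,
    (forall i v n n', n <= n' -> be i v n -> be i v n') /\
    forall c v r, c \in Z -> v \in W b ->
      (reach g r c v <-> exists i m n, [/\ m + n <= r, al i c m & be i v n]).
  by case: b.
move=> /fin_all_exists[be abP].
exists (fun p S v => v \in W p.1 /\ exists c r m n,
  [/\ c \in Z, S = ball g c (Posz r), m + n <= r, al p.1 p.2 c m & be p.1 p.2 v n]).
split=> [[b i] v w /=|S [c [r [cZ ES]]] v].
  have [vW|vW] := boolP (v \in W b); last by left=> S [].
  have [wW|wW] := boolP (w \in W b); last by right=> S [].
  (* If some budget reaches [v] but not [w], every budget that reaches [w] is larger and reaches [v]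
     too. *)
  case: (classic (forall n, be b i v n -> be b i w n)) => [vw|/not_all_ex_not[n nvw]].
    by left=> S [_ [c [r [m [n [cZ ES mn a /vw be']]]]]]; split=> //; exists c, r, m, n.
  right=> S [_ [c [r [m [n' [cZ ES mn a wn']]]]]]; split=> //; exists c, r, m, n'.
  split=> //; have [vn nwn] := imply_to_and _ _ nvw.
  by have [le|/ltnW le] := leqP n n'; [apply: (abP b).1 vn|case: nwn; apply: (abP b).1 wn'].
move=> vW; split=> [vS|[[b i] [/= vWb [c' [r' [m [n [c'Z ES' mn a be']]]]]]]].
  have [b vWb] : exists b, v \in W b.
    by move: vW; rewrite inE => /orP[]; [exists true|exists false].
  move: vS; rewrite ES inE => /((abP b).2 _ _ _ cZ vWb)[i [m [n [mn a be']]]].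
  by exists (b, i); split=> //; exists c, r, m, n.
by rewrite ES' inE; apply/((abP b).2 _ _ _ c'Z vWb); exists i, m, n.
Qed.

(** * Isolating the centre between two cuts *)

Definition join_cut (T : finType) (F : {set {set T}}) (x y : T) : {set T} :=
  [arg min_(A < [set: T] | [&& A \in F, x \in A & y \in A]) #|A|].

(** Sets containing [z] score 0 and the others their size, so the maximum avoids [z] as soon as some
    candidate does. It is defined for all arguments because the decoder may meet any scene. *)
Definition avoiding_cut (T : finType) (F : {set {set T}}) (x : T) (oz : option T) : {set T} :=
  if oz is Some z
  then [arg max_(A > [set: T] | (A \in F) && (x \in A)) (z \notin A) * #|A|]
  else [set: T].

(** Members through a common point form a chain, so extremal size means extremal inclusion. *)
Lemma cut_nested (t : nat) (T : finType) (g : rel T) (F : {set {set T}})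
    (A B : {set T}) (x : T) :
  cut_family t g F -> A \in F -> B \in F -> x \in A -> x \in B ->
  #|A| <= #|B| -> A \subset B.
Proof.
move=> cF AF BF xA xB AB; have [//|BA|] := cut_laminar cF AF BF.
  by have /eqP -> : B == A by rewrite eqEcard BA.
by rewrite -setI_eq0 => /eqP AB0; have := in_set0 x; rewrite -AB0 inE xA xB.
Qed.

Lemma join_cutP (t : nat) (T : finType) (g : rel T) (F : {set {set T}}) (x y : T) :
  cut_family t g F ->
  [/\ join_cut F x y \in F, x \in join_cut F x y, y \in join_cut F x y
    & forall A, A \in F -> x \in A -> y \in A -> join_cut F x y \subset A].
Proof.
move=> cF; rewrite /join_cut; case: arg_minnP => [|Q /and3P[QF xQ yQ] Qmin].
  by rewrite (cut_full cF) !inE.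
split=> // A AF xA yA; apply: (cut_nested cF QF AF xQ xA).
by apply: Qmin; rewrite AF xA.
Qed.

Lemma avoiding_cut_in (t : nat) (T : finType) (g : rel T) (F : {set {set T}})
    (x : T) (oz : option T) :
  cut_family t g F -> avoiding_cut F x oz \in F /\ x \in avoiding_cut F x oz.
Proof.
move=> cF; case: oz => [z|] /=; last by rewrite (cut_full cF) inE.
case: arg_maxnP => [|P /andP[PF xP] _ //].
by rewrite (cut_full cF) inE.
Qed.

Lemma avoiding_cutP (t : nat) (T : finType) (g : rel T) (F : {set {set T}})
    (x z : T) (A : {set T}) :
  cut_family t g F -> A \in F -> x \in A -> z \notin A ->
  z \notin avoiding_cut F x (Some z) /\ A \subset avoiding_cut F x (Some z).
Proof.
move=> cF AF xA zA; rewrite /avoiding_cut; case: arg_maxnP => [|P /andP[PF xP] Pmax].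
  by rewrite (cut_full cF) inE.
have := Pmax A; rewrite AF xA zA mul1n => /(_ isT).
have A0 : 0 < #|A| by rewrite card_gt0; apply/set0Pn; exists x.
case: (z \in P) => /=; first by rewrite mul0n => /(leq_trans A0).
by rewrite mul1n; split=> //; apply: (cut_nested cF AF PF xA xP).
Qed.

(** Let [p] be the smallest member containing [c] and meeting [M]. By minimality its child around
    [c] misses [M], so the other child contains [p :&: M]; [Q] fits inside that child and [P]
    surrounds [p]. *)
Lemma isolating_cuts (t : nat) (T : finType) (g : rel T) (F : {set {set T}})
    (c : T) (M : {set T}) :
  cut_family t g F -> M != set0 -> c \notin M ->
  exists x y oz, let Q := join_cut F x y in let P := avoiding_cut F x oz in
    [/\ x \in M, y \in M, forall z, oz = Some z -> z \in M, c \in P :\: Q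
      & M \subset Q :|: ~: P].
Proof.
move=> cF M0 cM.
pose meets (A : {set T}) := [&& A \in F, c \in A & A :&: M != set0].
have meetsT : meets setT by rewrite /meets (cut_full cF) inE setTI.
have [p /and3P[pF cp pM] pmin] := arg_minnP (P := meets) (fun A : {set T} => #|A|) meetsT.
have /set0Pn[x /setIP[xp xM]] := pM.
have [Ep|[A1 [A2 [A1F A2F cA1 A1p [cA2 Ep]]]]] := cut_split cF pF cp.
  by move: xp; rewrite Ep => /set1P Ex; rewrite -Ex xM in cM.
have pA2 v : v \in p -> v \in M -> v \in A2.
  move=> + vM; rewrite -{1}Ep inE => /orP[vA1|//].
  have := pmin A1; rewrite /meets A1F cA1 leqNgt (proper_card A1p) => /(_ _)/negP[] //=.
  by apply/set0Pn; exists v; rewrite inE vA1.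
(* Choosing [y] with the largest join makes [Q] contain all of [p :&: M]. *)
have x_in : x \in p :&: M by rewrite inE xp.
have [y /setIP[yp yM] ymax] := arg_maxnP (P := mem (p :&: M)) (fun y => #|join_cut F x y|) x_in.
have [QF xQ yQ Qmin] := join_cutP x y cF.
have cQ : c \notin join_cut F x y.
  apply: contra cA2; apply/subsetP; exact: Qmin (pA2 x xp xM) (pA2 y yp yM).
have pQ v : v \in p -> v \in M -> v \in join_cut F x y.
  move=> vp vM; have [RF xR vR _] := join_cutP x v cF.
  have : join_cut F x v \subset join_cut F x y.
    by apply: (cut_nested cF RF QF xR xQ); apply: ymax; rewrite /= inE vp.
  by move/subsetP; apply.
have [Mp|/subsetPn[z0 z0M z0p]] := boolP (M \subset p).
  exists x, y, None; split=> //=; first by rewrite !inE cQ.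
  by apply/subsetP => v vM; rewrite inE pQ ?(subsetP Mp).
(* Choosing [z] with the smallest avoiding cut makes [P] miss all of [M :\: p]. *)
have z0_in : z0 \in M :\: p by rewrite inE z0p.
have [z /setDP[zM zp] zmin] := arg_minnP (P := mem (M :\: p)) (fun z => #|avoiding_cut F x (Some z)|) z0_in.
have [zP pP] := avoiding_cutP cF pF xp zp.
exists x, y, (Some z); split=> // [_ [<-] //||].
  by rewrite inE cQ (subsetP pP).
apply/subsetP => v vM; rewrite !inE; have [vp|vp] := boolP (v \in p); first by rewrite pQ.
have [vP _] := avoiding_cutP cF pF xp vp.
have [PzF xPz] := avoiding_cut_in x (Some z) cF.
have [PvF xPv] := avoiding_cut_in x (Some v) cF.
apply/orP; right; apply: contra vP; apply/subsetP.
by apply: (cut_nested cF PzF PvF xPz xPv); apply: zmin; rewrite /= inE vp.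
Qed.

(** * The scheme for balls *)

(** Entries [Some true], [Some false], [None] are the points [x], [y], [z]. *)
Definition scene_balls (T : finType) (g : rel T) (F : {set {set T}})
    (s : {ffun option bool -> option T}) (S : {set T}) : Prop :=
  match s (Some true), s (Some false) with
  | Some x, Some y => centred g (avoiding_cut F x (s None) :\: join_cut F x y) S
  | Some x, None => centred g [set x] S
  | None, _ => S = set0
  end.

(** No [x] encodes a sample without positive points, realized by the empty ball; [x] without [y]
    encodes a ball whose centre is the sample point [x]. *)
Definition scene_domain (T : finType) (F : {set {set T}})
    (s : {ffun option bool -> option T}) : {set T} :=
  match s (Some true), s (Some false) with
  | Some x, Some y => join_cut F x y :|: ~: avoiding_cut F x (s None)
  | _, _ => setT
  end.

Lemma ball_scheme (t : nat) (T : finType) (g : rel T) (l : nat) :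
  0 < t -> symmetric g -> cliquewidth_le g t -> 3 + t.*2 * 2 < 2 ^ l ->
  exists kappa rho,
    proper_compression_scheme (ball_hyperedge g) kappa rho (3 + t.*2 * 2) (l * (3 + t.*2 * 2)).
Proof.
move=> t0 gC cwg ltl.
have [/card0_eq T0|Tn0] := posnP #|T|.
  exists (fun=> ((set0, set0), [::])), (fun=> set0).
  by split=> [X [S [[c _] _]]|Y b [S [[c _] _]]]; have := T0 c; rewrite inE.
have [F cF] := cliquewidth_cut_family Tn0 t0 cwg.
(* Three scene points, and two points for each of [t] chains on either side. *)
have cardK : #|{: option bool}| + #|{: bool * 'I_t}| * 2 = 3 + t.*2 * 2.
  by rewrite card_option card_prod card_bool card_ord mul2n.
rewrite -cardK; apply: (@scheme_of_scenes T _ _ _ (scene_balls g F) (scene_domain F)).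
- by rewrite cardK.
- move=> s S; rewrite /scene_balls.
  case: (s (Some true)) => [x|]; last first.
    by move=> ->; have /card_gt0P[c _] := Tn0; exists c, (Negz 0).
  by case: (s (Some false)) => [y|] [c [r [_ ->]]]; exists c, (Posz r).
- move=> s; rewrite /scene_balls /scene_domain.
  case: (s (Some true)) => [x|]; last first.
    exists (fun _ _ _ => False); split; first by left.
    by move=> S -> v _; rewrite inE; split=> [//|[]].
  case: (s (Some false)) => [y|]; last first.
    (* The whole vertex set serves as both sides, to match the index type of the two-cut case. *)
    by rewrite -(setUid setT); apply: gates_chain_union; apply: gates_point.
  have [QF _ _ _] := join_cutP x y cF; have [PF _] := avoiding_cut_in x (s None) cF.
  apply: gates_chain_union.
    by apply: gates_sub (gates_in gC cF QF); rewrite setDE subsetIr.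
  by apply: gates_sub (gates_out cF PF); rewrite setDE subsetIl.
move=> X [S [[c [r ES]] [X1S X2S]]].
have rS : realizes S X by rewrite /realizes setIC.
pose M := X.1 :|: X.2.
pose mk (x y z : option T) : {ffun option bool -> option T} :=
  [ffun b => match b with Some true => x | Some false => y | None => z end].
have [X10|X1n0] := eqVneq X.1 set0.
  exists (mk None None None), set0; rewrite /scene_balls /scene_domain !ffunE.
  split=> //; first by rewrite /realizes X10 set0I.
  by case=> [[]|] v; rewrite ffunE.
case: r ES => [r|r] ES; last first.
  by move: X1S; rewrite ES subset0 (negPf X1n0).
have Mn0 : M != set0.
  by apply: contraNneq X1n0 => M0; rewrite -subset0 -M0 subsetUl.
have [cM|cM] := boolP (c \in M).
  exists (mk (Some c) None None), S; rewrite /scene_balls /scene_domain !ffunE.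
  split=> //; first by exists c, r; rewrite inE.
  by case=> [[]|] v; rewrite ffunE // => -[<-].
have [x [y [oz [xM yM zM cPQ MPQ]]]] := isolating_cuts cF Mn0 cM.
exists (mk (Some x) (Some y) oz), S; rewrite /scene_balls /scene_domain !ffunE.
split=> //; first by exists c, r.
by case=> [[]|] v; rewrite ffunE; [move=> [<-]|move=> [<-]|apply: zM].
Qed.

(** * The size estimate *)

(** Split [u + 3] as [u.-1 + 4]: the first term is bounded by [2 ^ u.-1 < t.+1], and the other four
    by [2 <= t + 1]. *)
Lemma log2_bound (t : nat) : 0 < t ->
  Rle (Rmult (INR (up_log 2 t.+1 + 3)) (ln 2)) (Rmult 5 (ln (Rplus (INR t) R1))).
Proof.
move=> t0; set u := up_log 2 t.+1.
have u0 : 0 < u by rewrite up_log_gt0; lia.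
have ltu : 2 ^ u.-1 < t.+1 by apply: up_log_gtn.
have INR_exp n : INR (2 ^ n) = pow 2 n.
  by elim: n => // n IHn; rewrite expnS mult_INR IHn.
have ln_mono x y : Rlt 0 x -> Rle x y -> Rle (ln x) (ln y).
  by move=> x0 [/(ln_increasing _ _ x0)|->]; [left|right].
have lnu_le : Rle (Rmult (INR u.-1) (ln 2)) (ln (Rplus (INR t) R1)).
  rewrite -ln_pow; last lra.
  rewrite -INR_exp -S_INR; apply: ln_mono; last by apply: le_INR; apply/leP/ltnW.
  by apply: (lt_INR 0); apply/ltP; rewrite expn_gt0.
have ln2_le : Rle (ln 2) (ln (Rplus (INR t) R1)).
  apply: ln_mono; first lra.
  by have := le_INR 1 t (elimT leP t0); rewrite /=; lra.
have -> : INR (u + 3) = Rplus (INR u.-1) 4.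
  by rewrite -{1}(prednK u0) !plus_INR S_INR /=; lra.
lra.
Qed.

Theorem theorem1p2 :
  exists C : R, Rlt 0 C /\
  forall (t : nat), 0 < t ->
  forall (T : finType) (g : rel T),
    symmetric g -> irreflexive g -> cliquewidth_le g t ->
    exists (kappa : {set T} * {set T} -> ({set T} * {set T}) * seq bool)
           (rho : ({set T} * {set T}) * seq bool -> {set T}) (k1 k2 : nat),
      Rle (INR (k1 + k2)) (Rmult (Rmult C (INR t)) (ln (Rplus (INR t) R1))) /\
      proper_compression_scheme (ball_hyperedge g) kappa rho k1 k2.
Proof.
have ln2 : Rlt 0 (ln 2) by have := ln_lt_2; lra.
(* The constant is [7 * 5]: [K <= 7 * t], the total size is [(u + 3) * K], and [log2_bound] gives
   the 5. *)
exists (Rdiv 35 (ln 2)); split; first by apply: Rdiv_lt_0_compat; lra.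
move=> t t0 T g gC _ cwg; pose u := up_log 2 t.+1; pose K := 3 + t.*2 * 2.
(* [K] is [4 * t + 3], just below [4 * t.+1]. *)
have ltK : K < 2 ^ (u + 2).
  rewrite expnD; have : t.+1 <= 2 ^ u by apply: up_logP.
  by rewrite /K; lia.
have [kappa [rho scheme]] := ball_scheme t0 gC cwg ltK.
exists kappa, rho, K, ((u + 2) * K); split=> //.
have size_le : (K + (u + 2) * K <= 7 * t * (u + 3))%coq_nat by apply/leP; rewrite /K; nia.
apply: Rle_trans (le_INR _ _ size_le) _; rewrite !mult_INR.
have -> : INR 7 = IZR 7 by rewrite /=; lra.
apply: (Rmult_le_reg_r (ln 2)) => //.
have -> : Rmult (Rmult (Rmult (Rdiv 35 (ln 2)) (INR t)) (ln (Rplus (INR t) R1))) (ln 2)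
          = Rmult (Rmult 7 (INR t)) (Rmult 5 (ln (Rplus (INR t) R1))) by field; lra.
rewrite Rmult_assoc; apply: Rmult_le_compat_l; last exact: log2_bound.
by apply: Rmult_le_pos; [lra|exact: pos_INR].
Qed.
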